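(* Let $f_2(x)=\lfloor x\lfloor x\rfloor\rfloor$. Let $P(a,b,f_2)$ be the set of discontinuity points of $f_2$ in the interval $[a,b)$, and let $P(f_2)$ be the set of all discontinuity points of $f_2$ over the domain $x\ge 1$. Then $$P(f_2)=\bigcup_{k=1}^{+\infty}P(k,k+1,f_2)=\bigcup_{k=1}^{+\infty}\Bigl\{k,k+\tfrac{1}{k},k+\tfrac{2}{k},\dots,k+\tfrac{k-1}{k}\Bigr\},$$ or, equivalently, $$P(f_2)=\bigcup_{k=1}^{+\infty}\bigcup_{r=0}^{k-1}\Bigl\{k+\tfrac{r}{k}\Bigr\},$$ where $$|J(k,f_2)|=\frac{k^{2}-1}{k-1}=k+1\quad\text{for all } k\in\mathbb{Z}^{+},$$ and $$\Bigl|J\Bigl(k+\tfrac{r}{k},f_2\Bigr)\Bigr|=1\quad\text{for all } k\in\mathbb{Z}^{+}\text{, where } r\in\{1,2,\dots,k-1\}.$$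
   Context: For real $x$, $\lfloor x\rfloor$ is the greatest integer less than or equal to $x$. $\mathbb{Z}^{+}$ is the set of positive integers. For a jump discontinuity $d$ of a function $f$, $|J(d,f)|$ denotes the length of the jump, $|J(d,f)|=\bigl|\lim_{x\to d^{+}}f(x)-\lim_{x\to d^{-}}f(x)\bigr|$. In the convention used here, every positive integer (including $1$) counts as a discontinuity point of $\lfloor x\rfloor$ over the domain $x\ge 1$.
   Formalization: The formula |J(k,f_2)| = (k^2-1)/(k-1) = k+1 is stated for k ≥ 2 only, since at k = 1 the fraction is 0/0 and the actual jump of f_2 at 1 is 1 (from 0 to 1), not 2; that 1 is a jump discontinuity is kept. *)

(* Defs.v *)
From HB Require Import structures.
From mathcomp Require Import all_boot all_order all_algebra.
From mathcomp Require Import all_classical all_reals all_analysis.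
Import Order.TTheory GRing.Theory Num.Theory.
Import numFieldNormedType.Exports.

Set Implicit Arguments.
Unset Strict Implicit.
Unset Printing Implicit Defensive.

Local Open Scope classical_set_scope.
Local Open Scope ring_scope.

Definition f2 {R : realType} (x : R) : R :=
  (Num.floor (x * (Num.floor x)%:~R))%:~R.

(* Continuity is two-sided and f is a function on the whole real line, so an
   endpoint (in particular 1, for [disc_ge1]) is a discontinuity point as soon
   as f is discontinuous there from either side.
   The library's [discontinuity] means "jump discontinuity", and is used only
   as such. *)
Definition disc_in {R : realType} (a b : R) (f : R -> R) : set R :=
  [set x | a <= x < b /\ ~ {for x, continuous f}].

Definition disc_ge1 {R : realType} (f : R -> R) : set R :=
  [set x | 1 <= x /\ ~ {for x, continuous f}].

(* Meaningful only when [discontinuity f d] holds, since [lim] is total. *)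
Definition jump_length {R : realType} (d : R) (f : R -> R) : R :=
  `| lim (f x @[x --> d^'+]) - lim (f x @[x --> d^'-]) |.

(* Main.v *)
(* Cut [k, k + 1) at the points k + r / k.  On the cell
   [k + r / k, k + (r + 1) / k) the floor of x is k, so f2 x is the floor of
   k x, which is the constant k ^ 2 + r.  The last cell of [k, k + 1) ends at
   k + k / k = k + 1, so all discontinuities and jumps for x > 1 are read off
   from two adjacent cells; only the left side of 1, where f2 = 0, is apart. *)
Require Import Defs.
From HB Require Import structures.
From mathcomp Require Import all_boot all_order all_algebra.
From mathcomp Require Import all_classical all_reals all_analysis.
From mathcomp Require Import zify.
Import Order.TTheory GRing.Theory Num.Theory.
Import numFieldNormedType.Exports.

Local Open Scope classical_set_scope.
Local Open Scope ring_scope.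

Section one_sided_constant.
Context {R : realType}.
Implicit Types (f : R -> R) (a b c d p q : R).

Lemma cvg_at_right_eq_cst {f a b c} : a < b ->
  (forall x, a < x < b -> f x = c) -> f x @[x --> a^'+] --> c.
Proof.
move=> ab fc; apply: cvg_near_cst; near=> x; apply: fc; apply/andP; split.
  by near: x; exact: nbhs_right_gt.
by near: x; exact: nbhs_right_lt.
Unshelve. all: by end_near. Qed.

Lemma cvg_at_left_eq_cst {f a b c} : a < b ->
  (forall x, a < x < b -> f x = c) -> f x @[x --> b^'-] --> c.
Proof.
move=> ab fc; apply: cvg_near_cst; near=> x; apply: fc; apply/andP; split.
  by near: x; exact: nbhs_left_gt.
by near: x; exact: nbhs_left_lt.
Unshelve. all: by end_near. Qed.

Lemma jump_discontinuity {f d p q} : f x @[x --> d^'-] --> p ->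
  f x @[x --> d^'+] --> q -> p != q -> discontinuity f d.
Proof.
move=> fp fq pq; split; [exact: cvgP fp | exact: cvgP fq |].
by rewrite (cvg_lim _ fp)// (cvg_lim _ fq).
Qed.

Lemma jump_lengthE {f d p q} : f x @[x --> d^'-] --> p ->
  f x @[x --> d^'+] --> q -> jump_length d f = `|q - p|.
Proof.
by move=> fp fq; rewrite /jump_length (cvg_lim _ fp)// (cvg_lim _ fq).
Qed.

(** Continuity at [d] forces both one-sided limits to be [f d], so they could not differ. *)
Lemma discontinuity_not_continuous f d :
  discontinuity f d -> ~ {for d, continuous f}.
Proof.
move=> [_ _ /eqP fpq] /left_right_continuousP[fp fq]; apply: fpq.
by rewrite (cvg_lim _ fp)// (cvg_lim _ fq).
Qed.

End one_sided_constant.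

Section f2_cells.
Context {R : realType}.
Implicit Types (k r : nat) (x : R).

Definition cell_point k r : R := k%:R + r%:R / k%:R.

Lemma cell_point0 k : cell_point k 0 = k%:R.
Proof. by rewrite /cell_point mul0r addr0. Qed.

Lemma cell_pointnn k : (0 < k)%N -> cell_point k k = k.+1%:R.
Proof.
by move=> k0; rewrite /cell_point divff ?pnatr_eq0 -?lt0n// -natr1.
Qed.

Lemma ltr_cell_point k r s :
  (0 < k)%N -> (cell_point k r < cell_point k s) = (r < s)%N.
Proof.
by move=> k0; rewrite /cell_point ltrD2l ltr_pM2r ?invr_gt0 ?ltr0n// ltr_nat.
Qed.

Lemma ler_cell_point k r s :
  (0 < k)%N -> (cell_point k r <= cell_point k s) = (r <= s)%N.
Proof. by move=> k0; rewrite leNgt ltr_cell_point// -leqNgt. Qed.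

Lemma cell_point_itv k r : (r < k)%N -> k%:R <= cell_point k r < k.+1%:R.
Proof.
move=> rk; have k0 : (0 < k)%N by exact: leq_ltn_trans rk.
rewrite -cell_pointnn// -[X in X <= _]cell_point0.
by rewrite ler_cell_point// ltr_cell_point.
Qed.

Lemma cell_pointM k r : (0 < k)%N -> cell_point k r * k%:R = (k ^ 2 + r)%:R.
Proof.
move=> k0; rewrite /cell_point mulrDl divfK ?pnatr_eq0 -?lt0n//.
by rewrite natrD -mulnn natrM.
Qed.

(** The first bound fixes the inner floor, the second the outer one. The case [k = 0] serves the
    left side of 1. *)
Lemma f2_nat k m x : k%:R <= x < k.+1%:R -> m%:R <= x * k%:R < m.+1%:R ->
  f2 x = m%:R.
Proof.
move=> kx mx; rewrite /f2 (@floor_def _ x k%:Z); last by rewrite addrC.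
by rewrite (@floor_def _ _ m%:Z)// addrC.
Qed.

Lemma f2_cell k r x : (r < k)%N -> cell_point k r <= x < cell_point k r.+1 ->
  f2 x = (k ^ 2 + r)%:R.
Proof.
move=> rk /andP[lx xu]; have k0 : (0 < k)%N by exact: leq_ltn_trans rk.
apply: (@f2_nat k); apply/andP; split.
- by apply: le_trans lx; have /andP[] := cell_point_itv _ _ rk.
- by apply: lt_le_trans xu _; rewrite -cell_pointnn// ler_cell_point.
(* Multiplication by [k] carries the ends of the cell to the consecutive integers [k ^ 2 + r] and
   [k ^ 2 + r.+1]. *)
- by rewrite -cell_pointM// ler_pM2r// ltr0n.
- by rewrite -addnS -cell_pointM// ltr_pM2r// ltr0n.
Qed.

Lemma f2_cvg_right k r : (r < k)%N ->
  f2 x @[x --> (cell_point k r)^'+] --> ((k ^ 2 + r)%:R : R).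
Proof.
move=> rk; have k0 : (0 < k)%N by exact: leq_ltn_trans rk.
apply: (@cvg_at_right_eq_cst _ _ _ (cell_point k r.+1)).
  by rewrite ltr_cell_point.
by move=> x /andP[/ltW lx xu]; apply: f2_cell; rewrite ?lx.
Qed.

Lemma f2_cvg_left k r : (r < k)%N ->
  f2 x @[x --> (cell_point k r.+1)^'-] --> ((k ^ 2 + r)%:R : R).
Proof.
move=> rk; have k0 : (0 < k)%N by exact: leq_ltn_trans rk.
apply: (@cvg_at_left_eq_cst _ _ (cell_point k r)).
  by rewrite ltr_cell_point.
by move=> x /andP[/ltW lx xu]; apply: f2_cell; rewrite ?lx.
Qed.

Lemma f2_cvg_right_nat k : (0 < k)%N ->
  f2 x @[x --> k%:R^'+] --> ((k ^ 2)%:R : R).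
Proof. by move=> /f2_cvg_right; rewrite cell_point0 addn0. Qed.

(** The last cell of [[k.+1, k.+2)] has index [k] and ends at [k.+2]. The shift by two leaves out
    the point 1, which is the right end of no cell. *)
Lemma f2_cvg_left_nat k :
  f2 x @[x --> k.+2%:R^'-] --> ((k.+1 ^ 2 + k)%:R : R).
Proof. by have := f2_cvg_left k.+1 k (leqnn _); rewrite cell_pointnn. Qed.

Lemma f2_cvg_left1 : f2 x @[x --> 1^'-] --> (0 : R).
Proof.
apply: (@cvg_at_left_eq_cst _ _ 0) => // x /andP[/ltW x0 x1].
by apply: (@f2_nat 0 0); rewrite ?x0// mulr0 lexx ltr01.
Qed.

Lemma f2_discontinuity_nat k : (0 < k)%N -> discontinuity (@f2 R) k%:R.
Proof.
case: k => [//|[|k]] _.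
  apply: (jump_discontinuity f2_cvg_left1 (f2_cvg_right_nat 1 _)) => //.
  by rewrite eq_sym oner_eq0.
apply: (jump_discontinuity (f2_cvg_left_nat k) (f2_cvg_right_nat k.+2 _)) => //.
(* The left value [k.+1 ^ 2 + k] falls short of [k.+2 ^ 2] by [k.+3]. *)
by rewrite eqr_nat; lia.
Qed.

(** The pattern starts at 2: at the point 1 the one-sided limits are 0 and 1, so the jump there is 1
    and not 2. *)
Lemma f2_jump_nat k : jump_length k.+2%:R (@f2 R) = k.+3%:R.
Proof.
rewrite (jump_lengthE (f2_cvg_left_nat k) (f2_cvg_right_nat k.+2 _))//.
rewrite -natrB; last by lia.
by rewrite normr_nat; congr (_%:R); lia.
Qed.

(** The cells [r] and [r.+1] on the two sides belong to the same [[k, k + 1)], so their values are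
    consecutive integers. *)
Lemma f2_discontinuity_inner k r : (r.+1 < k)%N ->
  discontinuity (@f2 R) (cell_point k r.+1).
Proof.
move=> rk.
apply: (jump_discontinuity (f2_cvg_left k r (ltnW rk)) (f2_cvg_right k r.+1 rk)).
by rewrite eqr_nat; lia.
Qed.

Lemma f2_jump_inner k r : (r.+1 < k)%N ->
  jump_length (cell_point k r.+1) (@f2 R) = 1.
Proof.
move=> rk.
rewrite (jump_lengthE (f2_cvg_left k r (ltnW rk)) (f2_cvg_right k r.+1 rk)).
by rewrite addnS -natr1 addrAC subrr add0r normr1.
Qed.

Lemma f2_discontinuity_cell_point k r : (r < k)%N ->
  discontinuity (@f2 R) (cell_point k r).
Proof.
case: r => [|r] rk; last exact: f2_discontinuity_inner.
by rewrite cell_point0; exact: f2_discontinuity_nat.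
Qed.

Lemma f2_continuous_cell k r x : (r < k)%N ->
  cell_point k r < x < cell_point k r.+1 -> {for x, continuous (@f2 R)}.
Proof.
move=> rk /andP[lx xu]; apply/left_right_continuousP.
rewrite [X in _ --> X /\ _ --> X](f2_cell _ _ _ rk) ?(ltW lx)//; split.
  apply: (cvg_at_left_eq_cst lx) => y /andP[/ltW ly yx].
  by apply: f2_cell => //; rewrite ly (lt_trans yx).
apply: (cvg_at_right_eq_cst xu) => y /andP[xy yu].
by apply: f2_cell => //; rewrite yu (ltW (lt_trans lx xy)).
Qed.

(** Take [k] the floor of [x], [m] the floor of [x * k], and [r = m - k ^ 2]; scaling the cell by
    [k] gives back [m <= x * k < m.+1]. *)
Lemma cell_exists x : 1 <= x ->
  exists k r, (r < k)%N /\ cell_point k r <= x < cell_point k r.+1.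
Proof.
move=> x1; have x0 : 0 <= x by exact: le_trans x1.
have /andP[kx xk] := truncn_itv x0; set k := Num.truncn x in kx xk.
have k0 : (0 < k)%N by rewrite -ltnS -(ltr_nat R); exact: le_lt_trans xk.
have kR0 : 0 < k%:R :> R by rewrite ltr0n.
have /andP[mx xm] := truncn_itv (mulr_ge0 x0 (ltW kR0)).
set m := Num.truncn _ in mx xm.
(* From [k * k <= x * k < m.+1]; this keeps the subtraction [m - k ^ 2] from truncating. *)
have km : (k ^ 2 <= m)%N.
  rewrite -ltnS -(ltr_nat R) (le_lt_trans _ xm)// -mulnn natrM.
  by rewrite ler_pM2r.
(* From [m <= x * k < k.+1 * k]; this makes the index [r] smaller than [k]. *)
have mk : (m < k ^ 2 + k)%N.
  rewrite -(ltr_nat R) (le_lt_trans mx)// -mulnn -mulSnr natrM.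
  by rewrite ltr_pM2r.
exists k, (m - k ^ 2)%N; split; first by lia.
by rewrite -(ler_pM2r kR0) -(ltr_pM2r kR0) !cell_pointM// addnS subnKC// mx.
Qed.

Lemma disc_ge1_f2P x : disc_ge1 f2 x <->
  exists k r, (r < k)%N /\ x = cell_point k r.
Proof.
split=> [[x1 xD]|[k [r [rk ->]]]].
  have [k [r [rk /andP[lx xu]]]] := cell_exists _ x1.
  (* A point of the cell other than its left end is interior, where [f2] is locally constant. *)
  exists k, r; split=> //; apply: contrapT => /eqP xE; apply: xD.
  by apply: (f2_continuous_cell _ _ _ rk); rewrite lt_neqAle eq_sym xE lx.
split; last exact/discontinuity_not_continuous/f2_discontinuity_cell_point.
have /andP[+ _] := cell_point_itv _ _ rk; apply: le_trans.
by rewrite ler1n (leq_ltn_trans _ rk).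
Qed.

End f2_cells.

Theorem theorem4 (R : realType) :
  [/\ disc_ge1 (@f2 R) = \bigcup_(k >= 1) disc_in k%:R k.+1%:R (@f2 R),
      disc_ge1 (@f2 R) =
        \bigcup_(k >= 1) [set k%:R + r%:R / k%:R | r in [set r : nat | (r < k)%N]]
    & disc_ge1 (@f2 R) =
        \bigcup_(k >= 1) \bigcup_(r < k) [set k%:R + r%:R / k%:R]] /\
  [/\ forall k : nat, (1 <= k)%N -> discontinuity (@f2 R) k%:R,
      forall k : nat, (2 <= k)%N ->
        jump_length k%:R (@f2 R) = (k%:R ^+ 2 - 1) / (k%:R - 1) /\
        (k%:R ^+ 2 - 1) / (k%:R - 1) = k%:R + 1 :> R
    & forall k r : nat, (1 <= k)%N -> (1 <= r <= k - 1)%N ->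
        discontinuity (@f2 R) (k%:R + r%:R / k%:R) /\
        jump_length (k%:R + r%:R / k%:R) (@f2 R) = 1].
Proof.
split; split.
- apply/seteqP; split=> [x [x1 xD]|x [k /= k1 [/andP[kx _] xD]]]; last first.
    by split=> //; apply: le_trans kx; rewrite ler1n.
  (* The cell point equal to [x] supplies the index [k] of the interval containing it. *)
  have /disc_ge1_f2P[k [r [rk xE]]] : disc_ge1 f2 x by [].
  exists k; first by exact: leq_ltn_trans rk.
  by split=> //; rewrite xE; exact: cell_point_itv.
- apply/seteqP; split=> [x /disc_ge1_f2P[k [r [rk ->]]]|x [k /= _ [r /= rk <-]]].
    by exists k; [exact: leq_ltn_trans rk | exists r].
  by apply/disc_ge1_f2P; exists k, r.
- apply/seteqP; split=> [x /disc_ge1_f2P[k [r [rk ->]]]|x [k /= _ [r /= rk ->]]].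
    by exists k; [exact: leq_ltn_trans rk | exists r].
  by apply/disc_ge1_f2P; exists k, r.
- exact: f2_discontinuity_nat.
- case=> [//|[//|k]] _.
  (* The factor [k.+2 - 1] cancels because it is nonzero; at the point 1 the quotient would be 0 /
     0. *)
  have quotE : (k.+2%:R ^+ 2 - 1) / (k.+2%:R - 1) = k.+2%:R + 1 :> R.
    by rewrite subr_sqr_1 mulrAC divff ?mul1r// subr_eq0 pnatr_eq1.
  by rewrite quotE natr1 f2_jump_nat.
- move=> k [//|r] k1 rk; have {}rk : (r.+1 < k)%N by lia.
  by split; [exact: f2_discontinuity_inner | exact: f2_jump_inner].
Qed.
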